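(* Let $A\in\mathbb{R}^{m\times m}$ be a constant symmetric matrix and consider the DGSEM approximation, with one element per subdomain, polynomial degree $N\ge1$ and the upwind numerical flux, of the overset grid problem for $\boldsymbol\omega_t+A\boldsymbol\omega_x=0$ in one space dimension on $\Omega_u=[a,c]$ and $\Omega_v=[b,d]$, $a<b<c<d$, with zero physical external states; it is the linear ODE system for the nodal values $(\mathbf U_j)_{j=0}^N,(\mathbf V_j)_{j=0}^N$ given in the context. Then the eigenvalues of this system are stable: every eigenvalue of the matrix $\mathcal M$ for which the ODE system reads $\frac{d}{dt}\begin{bmatrix}\vec{\mathbf U}\\ \vec{\mathbf V}\end{bmatrix}=\mathcal M\begin{bmatrix}\vec{\mathbf U}\\ \vec{\mathbf V}\end{bmatrix}$ has non-positive real part.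
   Context: Let $\xi_j$ and $w_j>0$, $j=0,\dots,N$, be the Legendre-Gauss-Lobatto nodes (with $\xi_0=-1,\xi_N=1$) and weights on $[-1,1]$, $\ell_j$ the Lagrange interpolating polynomials of degree $N$ at these nodes, and $D_{jn}=\ell_n'(\xi_j)$ the derivative matrix. Let $|A|$ be the matrix absolute value of $A$ and $A^\pm=\frac12(A\pm|A|)$. Let $\Delta x_u=c-a$, $\Delta x_v=d-b$, and let $\xi_u(x)$, $\xi_v(x)$ be the affine increasing maps of $\Omega_u$, $\Omega_v$ onto $[-1,1]$. With $\mathbf U_j(t),\mathbf V_j(t)\in\mathbb{R}^m$ the nodal values, the approximation is $$\tfrac{\Delta x_u}{2}w_j\dot{\mathbf U}_j+\delta_{jN}\left(\tfrac12|A|\mathbf U_N+A^-\mathbf V(c)\right)+\delta_{j0}\,\tfrac12|A|\mathbf U_0+\tfrac12\sum_{n=0}^N(w_jD_{jn}-w_nD_{nj})A\mathbf U_n=0,$$ $$\tfrac{\Delta x_v}{2}w_j\dot{\mathbf V}_j+\delta_{jN}\,\tfrac12|A|\mathbf V_N-\delta_{j0}\left(A^+\mathbf U(b)-\tfrac12|A|\mathbf V_0\right)+\tfrac12\sum_{n=0}^N(w_jD_{jn}-w_nD_{nj})A\mathbf V_n=0,$$ for $j=0,\dots,N$, where the donor values are interpolated: $\mathbf V(c)=\sum_{n=0}^N\ell_n(\xi_v(c))\mathbf V_n$ and $\mathbf U(b)=\sum_{n=0}^N\ell_n(\xi_u(b))\mathbf U_n$. An eigenvalue is called unstable if it has positive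 real part and stable otherwise. *)

(* Defs.v *)
From HB Require Import structures.
From mathcomp Require Import all_boot all_order all_algebra complex.
From mathcomp Require Import all_classical all_reals all_analysis.

Set Implicit Arguments.
Unset Strict Implicit.
Unset Printing Implicit Defensive.

Import Order.TTheory GRing.Theory Num.Theory.
Import numFieldNormedType.Exports.

Local Open Scope classical_set_scope.
Local Open Scope ring_scope.

(* Rodrigues' formula. *)
Definition legendre (R : realType) (N : nat) : {poly R} :=
  (2 ^+ N * (N`!)%:R)^-1 *: (('X^2 - 1) ^+ N)^`(N).

Definition is_lgl_nodes (R : realType) (N : nat) (xi : 'I_N.+1 -> R) : Prop :=
  [/\ xi ord0 = -1,
      xi ord_max = 1,
      {homo xi : i j / (i < j)%N >-> i < j}
    & forall j, j != ord0 -> j != ord_max ->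
        root (legendre R N)^`() (xi j)].

(* qpoly's [lagrange] is not used: its theory asks for sampling points that are
   injective on the whole of nat. *)
Definition lagrange_poly (R : realType) (N : nat) (xi : 'I_N.+1 -> R)
    (n : 'I_N.+1) : {poly R} :=
  \prod_(k < N.+1 | k != n) ((xi n - xi k)^-1 *: ('X - (xi k)%:P)).

Definition lgl_weight (R : realType) (N : nat) (xi : 'I_N.+1 -> R)
    (j : 'I_N.+1) : R :=
  \int[@lebesgue_measure R]_(x in `[-1, 1]) (lagrange_poly xi j).[x].

Definition deriv_mx (R : realType) (N : nat) (xi : 'I_N.+1 -> R) :
    'M[R]_N.+1 :=
  \matrix_(j, n) ((lagrange_poly xi n)^`()).[xi j].

Definition is_absmx (R : realType) (m : nat) (A B : 'M[R]_m) : Prop :=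
  exists (Q : 'M[R]_m) (lambda : 'rV[R]_m),
    [/\ Q \in unitmx,
        A = Q *m diag_mx lambda *m invmx Q
      & B = Q *m diag_mx (map_mx Num.norm lambda) *m invmx Q].

(* |A| does not depend on the diagonalization chosen.  The default value 0 only
   concerns matrices that are not diagonalizable over R. *)
Definition absmx (R : realType) (m : nat) (A : 'M[R]_m) : 'M[R]_m :=
  xget 0 [set B | is_absmx A B].

Definition posmx (R : realType) (m : nat) (A : 'M[R]_m) : 'M[R]_m :=
  2^-1 *: (A + absmx A).

Definition negmx (R : realType) (m : nat) (A : 'M[R]_m) : 'M[R]_m :=
  2^-1 *: (A - absmx A).

(* The increasing affine map of [l, r] onto [-1, 1]. *)
Definition to_ref (R : realType) (l r x : R) : R :=
  2 * (x - l) / (r - l) - 1.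

(* The nodal values W_0, ..., W_N of a grid function are the columns of W. *)
Definition interp (R : realType) (N m : nat) (xi : 'I_N.+1 -> R)
    (W : 'M[R]_(m, N.+1)) (s : R) : 'cV[R]_m :=
  \sum_(n < N.+1) (lagrange_poly xi n).[s] *: col n W.

Definition volume_term (R : realType) (N m : nat) (xi : 'I_N.+1 -> R)
    (A : 'M[R]_m) (W : 'M[R]_(m, N.+1)) (j : 'I_N.+1) : 'cV[R]_m :=
  let w := lgl_weight xi in
  let D := deriv_mx xi in
  2^-1 *: \sum_(n < N.+1) (w j * D j n - w n * D n j) *: (A *m col n W).

(* The semidiscrete equations as a relation between a state (U, V) and its time
   derivative (dU, dV). *)
Definition overset_dgsem (R : realType) (N m : nat) (xi : 'I_N.+1 -> R)
    (A : 'M[R]_m) (a b c d : R) (U V dU dV : 'M[R]_(m, N.+1)) : Prop :=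
  let w := lgl_weight xi in
  let Vc := interp xi V (to_ref b d c) in
  let Ub := interp xi U (to_ref a c b) in
  (forall j : 'I_N.+1,
     ((c - a) / 2 * w j) *: col j dU
     + (j == ord_max)%:R *:
         (2^-1 *: (absmx A *m col ord_max U) + negmx A *m Vc)
     + (j == ord0)%:R *: (2^-1 *: (absmx A *m col ord0 U))
     + volume_term xi A U j = 0)
  /\
  (forall j : 'I_N.+1,
     ((d - b) / 2 * w j) *: col j dV
     + (j == ord_max)%:R *: (2^-1 *: (absmx A *m col ord_max V))
     - (j == ord0)%:R *:
         (posmx A *m Ub - 2^-1 *: (absmx A *m col ord0 V))
     + volume_term xi A V j = 0).

(* The nodal values of U, then those of V, each stacked node by node. *)
Definition state_vec (R : realType) (N m : nat) (U V : 'M[R]_(m, N.+1)) :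
    'cV[R]_(N.+1 * m + N.+1 * m) :=
  col_mx (mxvec U^T)^T (mxvec V^T)^T.

(* The equivalence for all states and rates says that the equations read
   d/dt [U; V] = M [U; V]; it determines M. *)
Definition is_system_matrix (R : realType) (N m : nat) (xi : 'I_N.+1 -> R)
    (A : 'M[R]_m) (a b c d : R) (M : 'M[R]_(N.+1 * m + N.+1 * m)) : Prop :=
  forall U V dU dV : 'M[R]_(m, N.+1),
    overset_dgsem xi A a b c d U V dU dV <->
    state_vec dU dV = M *m state_vec U V.

(* Main.v *)
Require Import Defs.
From HB Require Import structures.
From mathcomp Require Import all_boot all_order all_algebra complex.
From mathcomp Require Import all_classical all_reals all_analysis.
From mathcomp Require Import polyrcf ring zify.
From mathcomp Require polyorder cauchyreals.

Set Implicit Arguments.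
Unset Strict Implicit.
Unset Printing Implicit Defensive.

Import Order.TTheory GRing.Theory Num.Theory.
Import numFieldNormedType.Exports.

Local Open Scope ring_scope.

(** In the eigenbasis of [A] the system splits into scalar advection problems of
    speed [lambda].  The upwind flux makes each of them block triangular: for
    [lambda >= 0] the equations for [U] do not see [V], for [lambda <= 0] those
    for [V] do not see [U].  On a decoupled block the volume term is
    antisymmetric and the interface terms are dissipative, so that testing an
    eigenvector against itself in the inner product weighted by the [w_j > 0]
    excludes [Re z > 0] unless the block component vanishes; the other block is
    then decoupled as well.  How the donor value is interpolated is irrelevant.
*)

(** * Integration of polynomials over [-1, 1] *)

Definition itg (R : realType) (p : {poly R}) : R :=
  \int[@lebesgue_measure R]_(x in `[-1, 1]%classic) p.[x].

(** Termwise integration, possible in characteristic 0. Writing an integrand as a derivative turns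
    the facts about [itg] below into statements about end point values. *)
Lemma deriv_surjective (R : numFieldType) (p : {poly R}) :
  exists F : {poly R}, F^`() = p.
Proof.
exists (\poly_(i < (size p).+1) (p`_i.-1 / i%:R)); apply/polyP => i.
rewrite coef_deriv coef_poly ltnS /=.
case: ltnP => [_|le_p_i]; last by rewrite mul0rn nth_default.
by rewrite -(mulr_natr (_ / _)) divfK // pnatr_eq0.
Qed.

Lemma itg_deriv (R : realType) (F : {poly R}) :
  itg F^`() = F.[1] - F.[-1].
Proof.
rewrite /itg /Rintegral (@continuous_FTC2 R _ (horner F)) //.
- exact/continuous_subspaceT/continuous_horner.
- split.
  + by move=> x _; exact: derivable_horner.
  + exact/cvg_at_right_filter/continuous_horner.
  + exact/cvg_at_left_filter/continuous_horner.
- by move=> x _; rewrite derivE.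
Qed.

Lemma itgD (R : realType) (p q : {poly R}) : itg (p + q) = itg p + itg q.
Proof.
have [[F <-] [G <-]] := (deriv_surjective p, deriv_surjective q).
by rewrite -derivD !itg_deriv !hornerD; ring.
Qed.

Lemma itgZ (R : realType) (a : R) (p : {poly R}) : itg (a *: p) = a * itg p.
Proof.
have [F <-] := deriv_surjective p.
by rewrite -derivZ !itg_deriv !hornerZ -mulrBr.
Qed.

Lemma itg_by_parts (R : realType) (p q : {poly R}) :
  p.[1] * q.[1] = 0 -> p.[-1] * q.[-1] = 0 ->
  itg (p^`() * q) = - itg (p * q^`()).
Proof.
move=> pq1 pqN1; apply/eqP; rewrite -addr_eq0 -itgD -derivM itg_deriv.
by rewrite !hornerM pq1 pqN1 subrr.
Qed.

(** An antiderivative is nondecreasing on [-1, 1]. Were its end point values equal, it would be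
    constant there, hence constant as a polynomial, and its derivative would be zero. *)
Lemma itg_gt0 (R : realType) (p : {poly R}) :
  p != 0 -> (forall x, -1 <= x <= 1 -> 0 <= p.[x]) -> 0 < itg p.
Proof.
have [F <-] := deriv_surjective p => F'_neq0 F'_ge0.
have leF : {in `[-1, 1] &, {homo horner F : x y / x <= y}}.
  apply: ler_hornerW => x; rewrite in_itv /= => /andP[lt_x gt_x].
  by rewrite F'_ge0 // !ltW.
have leN11 : -1 <= 1 :> R by rewrite (@le_trans _ _ 0) ?oppr_le0 ?ler01.
have N1in : -1 \in `[-1 : R, 1] by rewrite in_itv /= lexx leN11.
have in1 : 1 \in `[-1 : R, 1] by rewrite in_itv /= lexx leN11.
rewrite itg_deriv subr_gt0 lt_neqAle leF // andbT.
apply: contra F'_neq0 => /eqP eqF.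
pose G := F - F.[1]%:P.
suff /eqP G0 : G == 0 by rewrite -[F](subrK F.[1]%:P) -/G G0 add0r derivC.
apply/negPn/negP => G_neq0.
(* The points 1/(k+1) lie in [-1, 1] and are distinct; [size G] of them are one more than the degree
   of [G]. *)
pose rs := [seq k.+1%:R^-1 : R | k <- iota 0 (size G)].
suff : (size rs < size G)%N by rewrite size_map size_iota ltnn.
apply: max_poly_roots => //.
  apply/allP => _ /mapP[k _ ->]; rewrite /root /G !hornerE subr_eq0 eq_le.
  have inv_le1 : (k.+1%:R : R)^-1 <= 1 by rewrite invf_le1 ?ler1n ?ltr0n.
  have N1_le_inv : -1 <= (k.+1%:R : R)^-1.
    by rewrite (@le_trans _ _ 0) ?oppr_le0 ?ler01 ?invr_ge0 ?ler0n.
  by rewrite leF ?in_itv /= ?N1_le_inv ?inv_le1 // -eqF leF ?in_itv /= ?N1_le_inv.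
rewrite map_inj_uniq ?iota_uniq // => i j /invr_inj /eqP.
by rewrite eqr_nat eqSS => /eqP.
Qed.

(** * Diagonalization of symmetric matrices and the matrix absolute value *)

(** The spectral theorem is applied over R[i]. The spectrum is real there, so [A] and its diagonal
    form are real matrices similar over R[i], hence similar over R. *)
Lemma real_symmetric_diagonalizable (R : realType) (m : nat) (A : 'M[R]_m) :
  A^T = A -> exists (Q : 'M[R]_m) (l : 'rV[R]_m),
    Q \in unitmx /\ A = Q *m diag_mx l *m invmx Q.
Proof.
move=> symA; set f := real_complex R.
pose B := map_mx f A; pose s := spectral_diag B.
have realf k n (X : 'M[R]_(k, n)) : map_mx f X \is a mxOver Num.real.
  by apply/mxOverP => i j; rewrite mxE; apply/complex_realP; exists (X i j).
have fRe k n (X : 'M[R[i]]_(k, n)) :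
    X \is a mxOver Num.real -> map_mx f (map_mx (@complex.Re R) X) = X.
  move=> /mxOverP realX; apply/matrixP => i j.
  by rewrite !mxE; exact: RRe_real.
have hermB : B \is hermsymmx.
  apply: realsym_hermsym; last exact: realf.
  apply/is_hermitianmxP; rewrite expr0 scale1r map_mx_id //.
  by rewrite /B matrix.map_trmx symA.
have reals : s \is a mxOver Num.real by exact: hermitian_spectral_diag_real.
have [S unitS specB] : exists2 S, S \in unitmx & S *m B = diag_mx s *m S.
  exists (spectralmx B); first exact: spectral_unit.
  have /orthomx_spectralP {2}-> := hermitian_normalmx hermB.
  by rewrite !mulmxA mulmxV ?spectral_unit // mul1mx.
have realD : diag_mx s \is a mxOver Num.real.
  apply/mxOverP => i j; rewrite mxE; case: eqP => _; last exact: real0.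
  by rewrite mulr1n (mxOverP reals).
(* The complex transition matrix is exchanged for a real one. *)
have [] := @real_similar R[i] m B (diag_mx s) _ (realf _ _ _) realD.
  by exists S => //; apply/similarP.
move=> P /andP[realP unitP] /(similarP unitP) eqP_.
pose Q := map_mx (@complex.Re R) P; pose l := map_mx (@complex.Re R) s.
have unitQ : Q \in unitmx by rewrite -(map_unitmx f) fRe.
exists (invmx Q), l; rewrite unitmx_inv; split=> //.
rewrite invmxK -mulmxA; suff <- : Q *m A = diag_mx l *m Q by rewrite mulKmx.
by apply: (@map_mx_inj _ _ f); rewrite !map_mxM map_diag_mx !fRe.
Qed.

(** Symmetry provides a diagonalization, which rules out the default value of [xget] and yields a
    common eigenbasis of A and |A|. *)
Lemma absmx_diagonalization (R : realType) (m : nat) (A : 'M[R]_m) :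
  A^T = A -> is_absmx A (absmx A).
Proof.
move=> /real_symmetric_diagonalizable[Q [l [unitQ defA]]].
apply: (@xgetPex _ 0 [set B | is_absmx A B]%classic).
by exists (Q *m diag_mx (map_mx Num.norm l) *m invmx Q), Q, l.
Qed.

(** * Orthogonality of the Legendre polynomials and their derivatives *)

(** Each differentiation lowers the order of a zero by at most one. *)
Lemma derivn_dvdp_XsubC_exp (R : numDomainType) (a : R) (q : {poly R}) (k n : nat) :
  exists r, (q * ('X - a%:P) ^+ (k + n))^`(k) = r * ('X - a%:P) ^+ n.
Proof.
elim: k n => [|k IHk] n; first by exists q.
have [r rE] := IHk n.+1; exists (r^`() * ('X - a%:P) + r *+ n.+1).
rewrite derivnS addSnnS rE derivM deriv_exp derivXsubC mul1r /=.
by rewrite exprS -mulr_natr -[r *+ _]mulr_natr; ring.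
Qed.

(** Repeated integration by parts: the boundary terms vanish because 1 and -1 are zeros of order N
    of (X^2 - 1)^N, and [h] loses a degree each time until it is zero. *)
Lemma rodrigues_orthogonal (R : realType) (N k : nat) (h : {poly R}) :
  (k <= N)%N -> (size h <= k)%N ->
  itg ((('X^2 - 1) ^+ N)^`(k) * h) = 0.
Proof.
elim: k h => [|k IHk] h lekN szh.
  move: szh; rewrite leqn0 size_poly_eq0 => /eqP ->.
  by rewrite mulr0 -(scale0r 0) itgZ mul0r.
have facE : ('X^2 - 1) ^+ N =
    ('X - (- 1)%:P) ^+ N * ('X - 1%:P) ^+ N :> {poly R}.
  by rewrite -exprMn polyCN polyC1; congr (_ ^+ _); ring.
(* After k < N derivatives a factor of positive order is left at each end point. *)
have split_N : N = (k + (N - k.+1).+1)%N by lia.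
have root1 : (('X^2 - 1) ^+ N)^`(k).[1] = 0 :> R.
  rewrite facE {2}split_N.
  have [r ->] := derivn_dvdp_XsubC_exp (1 : R) (('X - (- 1)%:P) ^+ N) k (N - k.+1).+1.
  by rewrite exprS !hornerM hornerXsubC subrr mul0r mulr0.
have rootN1 : (('X^2 - 1) ^+ N)^`(k).[-1] = 0 :> R.
  rewrite facE mulrC {2}split_N.
  have [r ->] := derivn_dvdp_XsubC_exp (-1 : R) (('X - 1%:P) ^+ N) k (N - k.+1).+1.
  by rewrite exprS !hornerM hornerXsubC subrr mul0r mulr0.
rewrite derivnS itg_by_parts ?root1 ?rootN1 ?mul0r //.
rewrite IHk ?oppr0 ?(ltnW lekN) //.
by rewrite polyorder.size_deriv -subn1 leq_subLR add1n.
Qed.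

(** The degree is N - 1, so the interior Lobatto nodes will exhaust the roots. *)
Lemma size_legendre_deriv (R : realType) (N : nat) :
  (1 <= N)%N -> size (legendre R N)^`() = N.
Proof.
move=> N_gt0; rewrite /legendre derivZ size_scale; last first.
  by rewrite invr_eq0 mulf_neq0 ?expf_neq0 ?pnatr_eq0 // -lt0n fact_gt0.
rewrite -derivnS cauchyreals.size_derivn.
have sz2 : size ('X^2 - 1 : {poly R}) = 3 by rewrite size_XnsubC.
have F_neq0 : ('X^2 - 1) ^+ N != 0 :> {poly R}.
  by rewrite expf_neq0 // -size_poly_eq0 sz2.
by rewrite (polySpred F_neq0) size_exp sz2; lia.
Qed.

(** The factor X^2 - 1 kills the boundary terms of one integration by parts. This moves the
    derivative to (X^2 - 1) g, whose derivative has degree below N, so Legendre orthogonality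
    applies. *)
Lemma legendre_deriv_orthogonal (R : realType) (N : nat) (g : {poly R}) :
  (size g < N)%N -> itg (('X^2 - 1) * (legendre R N)^`() * g) = 0.
Proof.
move=> szg; rewrite [_ * _^`()]mulrC -mulrA.
have szd : (size (('X^2 - 1) * g)^`() <= N)%N.
  rewrite polyorder.size_deriv -subn1 leq_subLR add1n.
  by rewrite (leq_trans (size_polyMleq _ _)) // size_XnsubC // ltnS.
have vanish (x : R) : x ^+ 2 = 1 -> (legendre R N).[x] * (('X^2 - 1) * g).[x] = 0.
  by move=> x2; rewrite hornerM hornerD hornerXn x2 hornerN hornerC subrr mul0r mulr0.
rewrite itg_by_parts ?vanish ?sqrrN ?expr1n //.
by rewrite /legendre -scalerAl itgZ rodrigues_orthogonal ?mulr0 ?oppr0.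
Qed.

(** * Lobatto quadrature and positivity of its weights *)

Section LobattoNodes.
Variables (R : realType) (N : nat) (xi : 'I_N.+1 -> R).
Hypotheses (hN : (1 <= N)%N) (hxi : is_lgl_nodes xi).

Lemma lgl_nodes_inj : injective xi.
Proof.
have [_ _ mono_xi _] := hxi => i j eq_ij; apply/val_inj.
by case: (ltngtP i j) => // /mono_xi; rewrite eq_ij ltxx.
Qed.

Lemma lgl_nodes_bound j : -1 <= xi j <= 1.
Proof.
have [xi0 xiN mono_xi _] := hxi.
have le_xi (i k : 'I_N.+1) : (i <= k)%N -> xi i <= xi k.
  rewrite leq_eqVlt => /orP[/eqP/val_inj -> //|/mono_xi]; exact: ltW.
by rewrite -{1}xi0 -xiN !le_xi // -ltnS.
Qed.

(** The interior nodes are N - 1 distinct roots of a polynomial of degree N - 1, which therefore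
    splits into the corresponding linear factors. *)
Lemma lgl_node_poly : exists c : R,
  \prod_k ('X - (xi k)%:P) = c *: (('X^2 - 1) * (legendre R N)^`()).
Proof.
have [xi0 xiN _ root_xi] := hxi.
pose s := [seq k <- enum 'I_N.+1 | (k != ord0) && (k != ord_max)].
have sE (F : 'I_N.+1 -> {poly R}) :
    \prod_(k <- s) F k = \prod_(k | (k != ord0) && (k != ord_max)) F k.
  by rewrite big_filter big_enum_cond.
have Nneq0 : ord_max != ord0 :> 'I_N.+1 by rewrite -val_eqE /= -lt0n.
(* As N >= 1, the two end points have distinct indices, which leaves N - 1 interior ones. *)
have szs : (size s).+2 = N.+1.
  rewrite /s size_filter -[RHS](card_ord N.+1) -sum1_card (bigD1 ord0) //=.
  by rewrite (bigD1 ord_max) //= sum1_count /index_enum -enumT.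
set L := (legendre R N)^`().
have szL : size L = N by exact: size_legendre_deriv.
have L_neq0 : L != 0 by rewrite -size_poly_eq0 szL -lt0n.
pose W := \prod_(k <- s) ('X - (xi k)%:P).
have LE : L = lead_coef L *: W.
  rewrite /W -(big_map xi predT (fun x => 'X - x%:P)).
  apply: all_roots_prod_XsubC.
  - by rewrite size_map szL; case: szs.
  - apply/allP => _ /mapP[k ks ->].
    move: ks; rewrite mem_filter => /andP[/andP[k0 kN] _].
    exact: root_xi.
  - by rewrite uniq_rootsE (map_inj_uniq lgl_nodes_inj) filter_uniq // enum_uniq.
have WE : W = (lead_coef L)^-1 *: L.
  by rewrite {2}LE scalerA mulVf ?scale1r // lead_coef_eq0.
exists (lead_coef L)^-1.
rewrite (bigD1 ord0) //= (bigD1 ord_max) //= -sE -/W WE xi0 xiN.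
by rewrite polyCN polyC1 -!scalerAr; congr (_ *: _); ring.
Qed.

Lemma itg_node_poly (g : {poly R}) :
  (size g < N)%N -> itg (\prod_k ('X - (xi k)%:P) * g) = 0.
Proof.
have [c ->] := lgl_node_poly => szg.
by rewrite -scalerAl itgZ legendre_deriv_orthogonal ?mulr0.
Qed.

Lemma lagrange_polyE j : lagrange_poly xi j =
  (\prod_(k | k != j) (xi j - xi k)^-1) *: \prod_(k | k != j) ('X - (xi k)%:P).
Proof. by rewrite /lagrange_poly scaler_prod. Qed.

(** This is exactness of the quadrature up to degree 2N - 1, for products with a Lagrange
    polynomial. Dividing h - h(xi_j) by X - xi_j leaves a quotient of size below N, and the product
    becomes a multiple of the node polynomial times that quotient, with integral zero. *)
Lemma lagrange_weightE j (h : {poly R}) :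
  (size h <= N)%N -> itg (lagrange_poly xi j * h) = h.[xi j] * lgl_weight xi j.
Proof.
move=> szh; have [g gE] : exists g, h - h.[xi j]%:P = g * ('X - (xi j)%:P).
  by apply/factor_theorem; rewrite /root !hornerE subrr.
have szg : (size g < N)%N.
  have [->|g_neq0] := eqVneq g 0; first by rewrite size_poly0.
  have <- : size (g * ('X - (xi j)%:P)) = (size g).+1.
    by rewrite size_Mmonic ?monicXsubC // size_XsubC addn2.
  rewrite -gE.
  by rewrite (leq_trans (size_polyD _ _)) // geq_max szh size_polyN
    (leq_trans (size_polyC_leq1 _)).
rewrite -[h in LHS](subrK h.[xi j]%:P) gE mulrDr itgD mulrC [_ * _%:P]mulrC.
rewrite mul_polyC itgZ -[lgl_weight xi j]/(itg _).
suff -> : itg (g * ('X - (xi j)%:P) * lagrange_poly xi j) = 0 by rewrite add0r.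
have nodeE : \prod_k ('X - (xi k)%:P) =
    ('X - (xi j)%:P) * \prod_(k | k != j) ('X - (xi k)%:P) by rewrite (bigD1 j).
rewrite lagrange_polyE -scalerAr itgZ -mulrA -nodeE [g * _]mulrC.
by rewrite itg_node_poly ?mulr0.
Qed.

(* With L_j and h_j the node polynomials without [xi j], resp. without [xi j]
   and the end points, L_j h_j has degree at most 2N - 1 and a constant sign on
   [-1, 1], and the quadrature sees only its value at [xi j]. *)
Lemma lgl_weight_gt0 j : 0 < lgl_weight xi j.
Proof.
have [xi0 xiN mono_xi _] := hxi.
pose X (k : 'I_N.+1) : {poly R} := 'X - (xi k)%:P.
pose inner (k : 'I_N.+1) := (k != ord0) && (k != ord_max).
pose E := \prod_(k | (k != j) && ~~ inner k) X k.
pose h := \prod_(k | (k != j) && inner k) X k.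
have LE : \prod_(k | k != j) X k = E * h.
  by rewrite (bigID inner) /= mulrC.
have hornerX x k : (X k).[x] = x - xi k by rewrite hornerXsubC.
have szh : (size h <= N)%N.
  have -> : h = \prod_(k in [pred k | (k != j) && inner k]) X k by [].
  rewrite -big_enum -(big_map xi predT (fun x => 'X - x%:P)) size_prod_XsubC.
  rewrite size_map -cardE.
  have: [pred k | (k != j) && inner k] \subset ~: [set ord0; ord_max].
    by apply/fintype.subsetP => k; rewrite !inE negb_or => /andP[].
  by move/subset_leq_card; rewrite cardsCs finset.setCK cards2 card_ord -val_eqE /=; lia.
pose q := E * h * h.
have q_neq0 : q.[xi j] != 0.
  have Xj k : k != j -> (X k).[xi j] != 0.
    by rewrite hornerX subr_eq0 (inj_eq lgl_nodes_inj) eq_sym.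
  rewrite /q -LE hornerM !horner_prod mulf_neq0 //; apply/prodf_neq0 => k.
    exact: Xj.
  by case/andP => /Xj.
(* The interior factors enter as a square, and each end point factor in [E] has a fixed sign on
   [-1, 1]. Multiplying by [q.[xi j]] avoids a case distinction on the resulting sign. *)
have qq_ge0 x : -1 <= x <= 1 -> 0 <= q.[xi j] * q.[x].
  move=> /andP[leN1x lex1]; have /andP[leN1j lej1] := lgl_nodes_bound j.
  have -> : q.[xi j] * q.[x] = E.[xi j] * E.[x] * (h.[xi j] * h.[x]) ^+ 2.
    by rewrite /q !hornerM; ring.
  rewrite mulr_ge0 ?sqr_ge0 // !horner_prod -big_split prodr_ge0 // => k.
  rewrite !hornerX negb_and !negbK => /andP[_ /orP[]/eqP ->].
  - by rewrite xi0 mulr_ge0 // subr_ge0.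
  - by rewrite xiN mulr_le0 // subr_le0.
have : 0 < itg (q.[xi j] *: q).
  apply: itg_gt0 => [|x xin]; last by rewrite hornerZ qq_ge0.
  by rewrite scaler_eq0 negb_or q_neq0; apply: contra_neq q_neq0 => ->; rewrite horner0.
pose e := \prod_(k | k != j) (xi j - xi k).
have e_neq0 : e != 0.
  by apply/prodf_neq0 => k; rewrite subr_eq0 (inj_eq lgl_nodes_inj) eq_sym.
have EhE : E * h = e *: lagrange_poly xi j.
  by rewrite lagrange_polyE prodfV scalerA mulfV // scale1r LE.
have eE : (E * h).[xi j] = e by rewrite -LE horner_prod; apply: eq_bigr.
(* [q] is [e] times the Lagrange polynomial times [h], and [h] is small enough for the
   quadrature. *)
have -> : itg (q.[xi j] *: q) = q.[xi j] ^+ 2 * lgl_weight xi j.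
  rewrite itgZ {2}/q EhE -scalerAl itgZ lagrange_weightE //.
  by rewrite {2}/q expr2 hornerM eE; ring.
by rewrite pmulr_rgt0 // exprn_even_gt0.
Qed.
End LobattoNodes.

(** * Energy estimate for a decoupled scalar block *)

(** Exchanging the two summation indices turns the form into its negative. *)
Lemma antisymmetric_form_eq0 (R : numDomainType) (I : finType) (S : I -> I -> R)
    (y : I -> R) :
  (forall j n, S j n = - S n j) -> \sum_j y j * (\sum_n S j n * y n) = 0.
Proof.
move=> antiS; set T := LHS.
suff T_N : T = - T.
  have : T *+ 2 == 0 by rewrite mulr2n {1}T_N addNr.
  by rewrite mulrn_eq0 => /eqP.
rewrite {1}/T.
under eq_bigr do rewrite mulr_sumr.
rewrite exchange_big -sumrN; apply: eq_bigr => n _ /=.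
rewrite mulr_sumr -sumrN; apply: eq_bigr => j _.
by rewrite antiS; ring.
Qed.

(** [y1] and [y2] are the real and imaginary parts of a mode with eigenvalue alpha + i beta. Testing
    the equations with [y1] and [y2] and adding leaves alpha times a weighted norm plus the
    dissipation at the two ends, all non-negative and of sum zero. *)
Lemma growing_mode_eq0 (R : realFieldType) (N : nat) (w : 'I_N.+1 -> R)
    (S : 'I_N.+1 -> 'I_N.+1 -> R) (kappa sigma lambda alpha beta : R)
    (y1 y2 : 'I_N.+1 -> R) :
  (forall j, 0 < w j) -> (forall j n, S j n = - S n j) ->
  0 < kappa -> 0 <= sigma -> 0 < alpha ->
  (forall j, kappa * w j * (alpha * y1 j - beta * y2 j)
     + (j == ord_max)%:R * (sigma * y1 ord_max)
     + (j == ord0)%:R * (sigma * y1 ord0)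
     + 2^-1 * (\sum_n S j n * (lambda * y1 n)) = 0) ->
  (forall j, kappa * w j * (beta * y1 j + alpha * y2 j)
     + (j == ord_max)%:R * (sigma * y2 ord_max)
     + (j == ord0)%:R * (sigma * y2 ord0)
     + 2^-1 * (\sum_n S j n * (lambda * y2 n)) = 0) ->
  forall j, y1 j = 0 /\ y2 j = 0.
Proof.
move=> w_gt0 antiS kappa_gt0 sigma_ge0 alpha_gt0 eq1 eq2.
pose e j := kappa * w j * alpha * (y1 j ^+ 2 + y2 j ^+ 2).
have e_ge0 j : 0 <= e j.
  by rewrite !mulr_ge0 ?addr_ge0 ?sqr_ge0 // ?ltW.
have sum_delta (i : 'I_N.+1) (y : 'I_N.+1 -> R) :
    \sum_j y j * ((j == i)%:R * (sigma * y i)) = sigma * y i ^+ 2.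
  rewrite (bigD1 i) //= eqxx big1 ?addr0 => [|j /negPf ->].
    by rewrite mulr1n; ring.
  by rewrite mul0r mulr0.
have sum_vol (y : 'I_N.+1 -> R) :
    \sum_j y j * (2^-1 * (\sum_n S j n * (lambda * y n))) = 0.
  transitivity (2^-1 * lambda * \sum_j y j * (\sum_n S j n * y n)); last first.
    by rewrite antisymmetric_form_eq0 ?mulr0.
  rewrite mulr_sumr; apply: eq_bigr => j _.
  have -> : \sum_n S j n * (lambda * y n) = lambda * (\sum_n S j n * y n).
    by rewrite mulr_sumr; apply: eq_bigr => n _; ring.
  ring.
pose a1 j := kappa * w j * (alpha * y1 j - beta * y2 j).
pose a2 j := kappa * w j * (beta * y1 j + alpha * y2 j).
pose L1 j := a1 j
     + (j == ord_max)%:R * (sigma * y1 ord_max)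
     + (j == ord0)%:R * (sigma * y1 ord0)
     + 2^-1 * (\sum_n S j n * (lambda * y1 n)).
pose L2 j := a2 j
     + (j == ord_max)%:R * (sigma * y2 ord_max)
     + (j == ord0)%:R * (sigma * y2 ord0)
     + 2^-1 * (\sum_n S j n * (lambda * y2 n)).
have energy : \sum_j e j + sigma * (y1 ord_max ^+ 2 + y1 ord0 ^+ 2
    + y2 ord_max ^+ 2 + y2 ord0 ^+ 2) = 0.
  transitivity (\sum_j (y1 j * L1 j + y2 j * L2 j)); last first.
    by apply: big1 => j _; rewrite /L1 /L2 /a1 /a2 eq1 eq2 !mulr0 addr0.
  (* The [beta] terms of the two equations cancel. *)
  have -> : \sum_j e j = \sum_j (y1 j * a1 j + y2 j * a2 j).
    by apply: eq_bigr => j _; rewrite /e /a1 /a2; ring.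
  under [RHS]eq_bigr do rewrite /L1 /L2 !mulrDr.
  rewrite !big_split /= !sum_delta !sum_vol.
  ring.
have sum_e0 : \sum_j e j = 0.
  apply/eqP; rewrite eq_le sumr_ge0 // andbT.
  move/eqP: energy; rewrite addr_eq0 => /eqP ->.
  by rewrite oppr_le0 mulr_ge0 // !addr_ge0 ?sqr_ge0.
move=> j; have /eqP := @psumr_eq0P _ _ _ _ (fun j _ => e_ge0 j) sum_e0 j isT.
have kwa : kappa * w j * alpha != 0 by rewrite !mulf_neq0 ?gt_eqF.
rewrite mulf_eq0 (negPf kwa) /= paddr_eq0 ?sqr_ge0 // !sqrf_eq0.
by case/andP => /eqP -> /eqP ->.
Qed.

(** * Matrices of linear maps and real forms of complex eigenvectors *)

Lemma linear_fun_mulmx (R : comNzRingType) (n p : nat)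
    (f : 'cV[R]_n -> 'cV[R]_p) :
  (forall k x y, f (k *: x + y) = k *: f x + f y) ->
  exists M : 'M[R]_(p, n), forall x, f x = M *m x.
Proof.
(* [lin1_mx] represents maps on row vectors, so [f] is conjugated by transposition. *)
move=> linf; pose g (r : 'rV[R]_n) : 'rV[R]_p := (f r^T)^T.
have ling : linear g by move=> k x y; rewrite /g !linearP linf linearP.
pose glin := GRing.isLinear.Build _ _ _ _ g ling.
pose G : {linear 'rV[R]_n -> 'rV[R]_p} := HB.pack g glin.
exists (lin1_mx G)^T => x.
by rewrite -[x in RHS]trmxK -trmx_mul mul_rV_lin1 /= /g !trmxK.
Qed.

Lemma eigenvalue_real_parts (R : rcfType) (n : nat) (M : 'M[R]_n) (z : R[i]) :
  eigenvalue (map_mx (real_complex R) M) z ->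
  exists x1 x2 : 'cV[R]_n,
    [/\ ~ (x1 = 0 /\ x2 = 0),
        M *m x1 = complex.Re z *: x1 - complex.Im z *: x2
      & M *m x2 = complex.Im z *: x1 + complex.Re z *: x2].
Proof.
set B := map_mx _ M => Bz.
(* [eigenvalue] refers to row vectors. The transpose has the same eigenvalues, and its row
   eigenvectors are the column eigenvectors needed here. *)
have /eigenvalueP[v vB v_neq0] : eigenvalue B^T z.
  move: Bz; rewrite /eigenvalue !kermx_eq0 !row_free_unit.
  by rewrite -[in X in _ -> X]unitmx_tr linearB /= trmxK tr_scalar_mx.
have eq_i (i : 'I_n) : \sum_j (M i j)%:C%C * v 0 j = z * v 0 i.
  have /matrixP/(_ 0 i) := vB; rewrite !mxE => <-.
  by apply: eq_bigr => j _; rewrite !mxE mulrC.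
exists (\col_i complex.Re (v 0 i)), (\col_i complex.Im (v 0 i)); split.
- case=> /colP x1_0 /colP x2_0; case/negP: v_neq0; apply/eqP/rowP => i.
  move: (x1_0 i) (x2_0 i); rewrite !mxE.
  by case: (v 0 i) => a b /= -> ->.
- apply/colP => i; rewrite !mxE; have := congr1 (@complex.Re R) (eq_i i).
  rewrite raddf_sum; case: z {Bz vB eq_i} (v 0 i) => a b [c d] /= <-.
  by apply: eq_bigr => j _; rewrite !mxE; case: (v 0 j) => ? ? /=; ring.
- apply/colP => i; rewrite !mxE; have := congr1 (@complex.Im R) (eq_i i).
  rewrite raddf_sum; case: z {Bz vB eq_i} (v 0 i) => a b [c d] /= E.
  rewrite [RHS]addrC -E.
  by apply: eq_bigr => j _; rewrite !mxE; case: (v 0 j) => ? ? /=; ring.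
Qed.

(** * Linearity of the spatial terms and coordinates of the state *)

Lemma interp_linear (R : realType) (N m : nat) (xi : 'I_N.+1 -> R) (s k : R)
    (W W' : 'M[R]_(m, N.+1)) :
  interp xi (k *: W + W') s = k *: interp xi W s + interp xi W' s.
Proof.
rewrite /interp scaler_sumr -big_split; apply: eq_bigr => n _ /=.
by apply/colP => i; rewrite !mxE; ring.
Qed.

Lemma mul_col_linear (R : comNzRingType) (N m p : nat) (B : 'M[R]_(p, m)) (k : R)
    (W W' : 'M[R]_(m, N)) (n : 'I_N) :
  B *m col n (k *: W + W') = k *: (B *m col n W) + B *m col n W'.
Proof. by rewrite !colE mulmxDl -scalemxAl mulmxDr -scalemxAr. Qed.

Lemma volume_term_linear (R : realType) (N m : nat) (xi : 'I_N.+1 -> R)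
    (A : 'M[R]_m) (k : R) (W W' : 'M[R]_(m, N.+1)) (j : 'I_N.+1) :
  volume_term xi A (k *: W + W') j =
  k *: volume_term xi A W j + volume_term xi A W' j.
Proof.
have scale_comb h (u v x : 'cV[R]_m) :
    x = k *: u + v -> h *: x = k *: (h *: u) + h *: v.
  by move=> ->; rewrite scalerDr !scalerA [h * k]mulrC.
apply: (scale_comb); rewrite scaler_sumr -big_split; apply: eq_bigr => n _ /=.
by apply: scale_comb; exact: mul_col_linear.
Qed.

Section StateVector.
Variables (R : realType) (N m : nat).

Definition state_U (x : 'cV[R]_(N.+1 * m + N.+1 * m)) : 'M[R]_(m, N.+1) :=
  (vec_mx (usubmx x)^T)^T.
Definition state_V (x : 'cV[R]_(N.+1 * m + N.+1 * m)) : 'M[R]_(m, N.+1) :=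
  (vec_mx (dsubmx x)^T)^T.

Lemma state_vecK x : state_vec (state_U x) (state_V x) = x.
Proof. by rewrite /state_vec /state_U /state_V !trmxK !vec_mxK !trmxK vsubmxK. Qed.

Lemma state_vec_inj U V U' V' :
  state_vec U V = state_vec U' V' :> 'cV[R]_(N.+1 * m + N.+1 * m) ->
  U = U' /\ V = V'.
Proof.
by case/eq_col_mx => /trmx_inj/(can_inj mxvecK)/trmx_inj ->
  /trmx_inj/(can_inj mxvecK)/trmx_inj ->.
Qed.

Lemma state_vec_linear k U V U' V' :
  state_vec (k *: U + U') (k *: V + V') =
  k *: state_vec U V + state_vec U' V' :> 'cV[R]_(N.+1 * m + N.+1 * m).
Proof. by rewrite /state_vec !linearP /= scale_col_mx add_col_mx. Qed.

Lemma state_U_linear k x y : state_U (k *: x + y) = k *: state_U x + state_U y.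
Proof. by rewrite /state_U !linearP. Qed.

Lemma state_V_linear k x y : state_V (k *: x + y) = k *: state_V x + state_V y.
Proof. by rewrite /state_V !linearP. Qed.

End StateVector.

(** * The system matrix and the scalar modes of the overset system *)

Section OversetSystem.
Variables (R : realType) (N m : nat) (xi : 'I_N.+1 -> R) (A : 'M[R]_m).
Variables (a b c d : R).
Hypotheses (hN : (1 <= N)%N) (hxi : is_lgl_nodes xi).
Hypotheses (hac : a < c) (hbd : b < d).

(** Twice the antisymmetric part of the matrix with entries w_j D_jn. *)
Let S j n :=
  lgl_weight xi j * deriv_mx xi j n - lgl_weight xi n * deriv_mx xi n j.

(** All terms of the first equation except the time derivative; the other grid enters through the
    donor value only. *)
Let flux_U (U V : 'M[R]_(m, N.+1)) (j : 'I_N.+1) : 'cV[R]_m :=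
  (j == ord_max)%:R *: (2^-1 *: (absmx A *m col ord_max U)
    + negmx A *m interp xi V (to_ref b d c))
  + (j == ord0)%:R *: (2^-1 *: (absmx A *m col ord0 U))
  + volume_term xi A U j.

Let flux_V (U V : 'M[R]_(m, N.+1)) (j : 'I_N.+1) : 'cV[R]_m :=
  (j == ord_max)%:R *: (2^-1 *: (absmx A *m col ord_max V))
  - (j == ord0)%:R *: (posmx A *m interp xi U (to_ref a c b)
    - 2^-1 *: (absmx A *m col ord0 V))
  + volume_term xi A V j.

Let flux_U_linear k U V U' V' j :
  flux_U (k *: U + U') (k *: V + V') j = k *: flux_U U V j + flux_U U' V' j.
Proof.
rewrite /flux_U interp_linear volume_term_linear !mul_col_linear mulmxDr -scalemxAr.
by apply/colP => i; rewrite !mxE; ring.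
Qed.

Let flux_V_linear k U V U' V' j :
  flux_V (k *: U + U') (k *: V + V') j = k *: flux_V U V j + flux_V U' V' j.
Proof.
rewrite /flux_V interp_linear volume_term_linear !mul_col_linear mulmxDr -scalemxAr.
by apply/colP => i; rewrite !mxE; ring.
Qed.

Let rate (len : R) (flux : 'I_N.+1 -> 'cV[R]_m) : 'M[R]_(m, N.+1) :=
  \matrix_(i, j) (- (len / 2 * lgl_weight xi j)^-1 * flux j i 0).

Let rate_linear len k flux flux1 flux2 :
  (forall j, flux j = k *: flux1 j + flux2 j) ->
  rate len flux = k *: rate len flux1 + rate len flux2.
Proof.
move=> fluxE; apply/matrixP => i j; rewrite 4![in RHS]mxE mxE fluxE 2!mxE; ring.
Qed.

(** The mass matrix is diagonal with positive entries, so the equations can be solved for the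
    rates. *)
Let rateP len flux dW : 0 < len ->
  (forall j, (len / 2 * lgl_weight xi j) *: col j dW + flux j = 0) <->
  dW = rate len flux.
Proof.
move=> len_gt0.
have k_neq0 j : len / 2 * lgl_weight xi j != 0.
  by rewrite gt_eqF // mulr_gt0 ?divr_gt0 ?ltr0n ?lgl_weight_gt0.
split=> [eq_dW|-> j].
  apply/matrixP => i j; have /colP/(_ i) := eq_dW j; rewrite !mxE => /eqP.
  rewrite addr_eq0 => /eqP eq_ij; apply: (mulfI (k_neq0 j)).
  by rewrite eq_ij mulrA mulrN mulfV ?mulN1r.
by apply/colP => i; rewrite !mxE mulrA mulrN mulfV // mulN1r addNr.
Qed.

Let overset_rate U V dU dV :
  overset_dgsem xi A a b c d U V dU dV <->
  dU = rate (c - a) (flux_U U V) /\ dV = rate (d - b) (flux_V U V).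
Proof.
rewrite -!rateP ?subr_gt0 // /overset_dgsem.
by split=> -[eqU eqV]; split=> j; [rewrite -[RHS](eqU j) | rewrite -[RHS](eqV j)
  | rewrite -[RHS](eqU j) | rewrite -[RHS](eqV j)]; rewrite ?/flux_U ?/flux_V !addrA.
Qed.

(** The rates are an explicit linear function of the state. Uniqueness holds because every vector is
    the [state_vec] of some state and a matrix is determined by its action. *)
Lemma overset_system_matrix : exists! M, is_system_matrix xi A a b c d M.
Proof.
pose f x := state_vec (rate (c - a) (flux_U (state_U x) (state_V x)))
                      (rate (d - b) (flux_V (state_U x) (state_V x))).
have [|M fM] := @linear_fun_mulmx _ _ _ f.
  move=> k x y; rewrite /f -state_vec_linear state_U_linear state_V_linear.
  by congr state_vec; apply: rate_linear => j;
    rewrite ?flux_U_linear ?flux_V_linear.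
have MP : is_system_matrix xi A a b c d M.
  move=> U V dU dV; rewrite overset_rate -fM /f.
  have [-> ->] := state_vec_inj (state_vecK (state_vec U V)).
  by split=> [[-> ->] //|/state_vec_inj].
exists M; split=> // M' M'P.
have eqM (x : 'cV_(N.+1 * m + N.+1 * m)) : M *m x = M' *m x.
  rewrite -(state_vecK x) -[LHS]state_vecK.
  by apply/M'P/MP; rewrite state_vecK.
by apply/matrixP => i j; have /colP/(_ i) := eqM (delta_mx j 0);
  rewrite -!colE !mxE.
Qed.

(** A common left eigenvector [p] of A and |A| replaces these matrices by the scalars l and |l|, and
    A^+ and A^- by (l + |l|)/2 and (l - |l|)/2. *)
Lemma overset_mode (p : 'rV[R]_m) (l : R) (U V dU dV : 'M[R]_(m, N.+1)) :
  p *m A = l *: p -> p *m absmx A = `|l| *: p ->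
  overset_dgsem xi A a b c d U V dU dV ->
  (forall j, (c - a) / 2 * lgl_weight xi j * (p *m dU) 0 j
     + (j == ord_max)%:R * (`|l| / 2 * (p *m U) 0 ord_max
        + (l - `|l|) / 2 *
          \sum_n (lagrange_poly xi n).[to_ref b d c] * (p *m V) 0 n)
     + (j == ord0)%:R * (`|l| / 2 * (p *m U) 0 ord0)
     + 2^-1 * \sum_n S j n * (l * (p *m U) 0 n) = 0) /\
  (forall j, (d - b) / 2 * lgl_weight xi j * (p *m dV) 0 j
     + (j == ord_max)%:R * (`|l| / 2 * (p *m V) 0 ord_max)
     - (j == ord0)%:R * ((l + `|l|) / 2 *
          (\sum_n (lagrange_poly xi n).[to_ref a c b] * (p *m U) 0 n)
        - `|l| / 2 * (p *m V) 0 ord0)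
     + 2^-1 * \sum_n S j n * (l * (p *m V) 0 n) = 0).
Proof.
move=> pA pB [eqU eqV].
pose phi (v : 'cV[R]_m) := (p *m v) 0 0.
have phiD u v : phi (u + v) = phi u + phi v by rewrite /phi mulmxDr mxE.
have phiN v : phi (- v) = - phi v by rewrite /phi mulmxN mxE.
have phiZ k v : phi (k *: v) = k * phi v by rewrite /phi -scalemxAr mxE.
have phi0 : phi 0 = 0 by rewrite /phi mulmx0 mxE.
have phiS (F : 'I_N.+1 -> 'cV[R]_m) : phi (\sum_n F n) = \sum_n phi (F n).
  exact: (big_morph phi phiD phi0).
have phiA v : phi (A *m v) = l * phi v by rewrite /phi mulmxA pA -scalemxAl mxE.
have phiB v : phi (absmx A *m v) = `|l| * phi v.
  by rewrite /phi mulmxA pB -scalemxAl mxE.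
have phiC j (W : 'M[R]_(m, N.+1)) : phi (col j W) = (p *m W) 0 j.
  by rewrite /phi colE mulmxA -colE mxE.
have phi_neg v : phi (negmx A *m v) = (l - `|l|) / 2 * phi v.
  by rewrite /negmx -scalemxAl mulmxBl phiZ phiD phiN phiA phiB; ring.
have phi_pos v : phi (posmx A *m v) = (l + `|l|) / 2 * phi v.
  by rewrite /posmx -scalemxAl mulmxDl phiZ phiD phiA phiB; ring.
have phi_interp W s : phi (interp xi W s) =
    \sum_n (lagrange_poly xi n).[s] * (p *m W) 0 n.
  by rewrite phiS; apply: eq_bigr => n _; rewrite phiZ phiC.
have phi_vol W j : phi (volume_term xi A W j) =
    2^-1 * \sum_n S j n * (l * (p *m W) 0 n).
  by rewrite phiZ phiS; congr (_ * _); apply: eq_bigr => n _; rewrite phiZ phiA phiC.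
split=> j.
- have := congr1 phi (eqU j); rewrite !phiD phi_vol phi0 !phiZ !phiD phi_neg.
  rewrite phi_interp !phiZ !phiB !phiC => E; apply: etrans E; ring.
- have := congr1 phi (eqV j); rewrite !phiD phiN phi_vol phi0 !phiZ !phiD phiN phi_pos.
  rewrite phi_interp !phiZ !phiB !phiC => E; apply: etrans E; ring.
Qed.

Lemma overset_growing_mode_eq0 (p : 'rV[R]_m) (l alpha beta : R)
    (U1 V1 U2 V2 : 'M[R]_(m, N.+1)) :
  p *m A = l *: p -> p *m absmx A = `|l| *: p -> 0 < alpha ->
  overset_dgsem xi A a b c d U1 V1
    (alpha *: U1 - beta *: U2) (alpha *: V1 - beta *: V2) ->
  overset_dgsem xi A a b c d U2 V2
    (beta *: U1 + alpha *: U2) (beta *: V1 + alpha *: V2) ->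
  [/\ p *m U1 = 0, p *m V1 = 0, p *m U2 = 0 & p *m V2 = 0].
Proof.
move=> pA pB alpha_gt0 /(overset_mode pA pB)[U1E V1E] /(overset_mode pA pB)[U2E V2E].
have antiS j n : S j n = - S n j by rewrite opprB.
have w_gt0 := lgl_weight_gt0 hN hxi.
have sigma_ge0 : 0 <= `|l| / 2 by rewrite divr_ge0 ?ler0n.
have lenU : 0 < (c - a) / 2 by rewrite divr_gt0 ?subr_gt0 ?ltr0n.
have lenV : 0 < (d - b) / 2 by rewrite divr_gt0 ?subr_gt0 ?ltr0n.
pose eq0 (W : 'M[R]_(m, N.+1)) := forall n, (p *m W) 0 n = 0.
have eq0P W : eq0 W -> p *m W = 0 by move=> W0; apply/rowP => n; rewrite W0 mxE.
have expandB (W W' : 'M[R]_(m, N.+1)) j : (p *m (alpha *: W - beta *: W')) 0 j =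
    alpha * (p *m W) 0 j - beta * (p *m W') 0 j.
  by rewrite mulmxBr -!scalemxAr; move: (p *m W) (p *m W') => Y Y'; rewrite !mxE.
have expandD (W W' : 'M[R]_(m, N.+1)) j : (p *m (beta *: W + alpha *: W')) 0 j =
    beta * (p *m W) 0 j + alpha * (p *m W') 0 j.
  by rewrite mulmxDr -!scalemxAr; move: (p *m W) (p *m W') => Y Y'; rewrite !mxE.
pose donor (s : R) (W : 'M[R]_(m, N.+1)) :=
  \sum_n (lagrange_poly xi n).[s] * (p *m W) 0 n.
have donor0 s W : eq0 W -> donor s W = 0.
  by move=> W0; apply: big1 => n _; rewrite W0 mulr0.
(* The hypotheses ask only that the donor contribution vanish, be it through its coefficient or
   through the donor value; [stepU] and [stepV] can thus be used in either order. *)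
have stepU : (l - `|l|) / 2 * donor (to_ref b d c) V1 = 0 ->
    (l - `|l|) / 2 * donor (to_ref b d c) V2 = 0 -> eq0 U1 /\ eq0 U2.
  move=> dV1 dV2.
  have all0 n : (p *m U1) 0 n = 0 /\ (p *m U2) 0 n = 0.
    move: n; apply: (growing_mode_eq0 (lambda := l) (beta := beta)
      w_gt0 antiS lenU sigma_ge0 alpha_gt0) => j.
    - by move: (U1E j); rewrite -/(donor _ _) dV1 addr0 expandB.
    - by move: (U2E j); rewrite -/(donor _ _) dV2 addr0 expandD.
  by split=> n; case: (all0 n).
have stepV : (l + `|l|) / 2 * donor (to_ref a c b) U1 = 0 ->
    (l + `|l|) / 2 * donor (to_ref a c b) U2 = 0 -> eq0 V1 /\ eq0 V2.
  move=> dU1 dU2.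
  have all0 n : (p *m V1) 0 n = 0 /\ (p *m V2) 0 n = 0.
    move: n; apply: (growing_mode_eq0 (lambda := l) (beta := beta)
      w_gt0 antiS lenV sigma_ge0 alpha_gt0) => j.
    - by move: (V1E j); rewrite -/(donor _ _) dU1 add0r mulrN opprK expandB.
    - by move: (V2E j); rewrite -/(donor _ _) dU2 add0r mulrN opprK expandD.
  by split=> n; case: (all0 n).
(* The block with zero donor coefficient comes first; its vanishing makes the donor value of the
   other block zero. *)
have [l_ge0|/ltW l_le0] := leP 0 l.
- have [U1_0 U2_0] : eq0 U1 /\ eq0 U2.
    by apply: stepU; rewrite ger0_norm // subrr mul0r mul0r.
  have [V1_0 V2_0] : eq0 V1 /\ eq0 V2 by apply: stepV; rewrite donor0 ?mulr0.
  by split; apply: eq0P.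
- have [V1_0 V2_0] : eq0 V1 /\ eq0 V2.
    by apply: stepV; rewrite ler0_norm // subrr mul0r mul0r.
  have [U1_0 U2_0] : eq0 U1 /\ eq0 U2 by apply: stepU; rewrite donor0 ?mulr0.
  by split; apply: eq0P.
Qed.

End OversetSystem.

(** * Absence of growing modes in the full system *)

Theorem mainTheorem5 (R : realType) (m N : nat) (hN : (1 <= N)%N)
    (A : 'M[R]_m) (hA : A^T = A)
    (a b c d : R) (hab : a < b) (hbc : b < c) (hcd : c < d)
    (xi : 'I_N.+1 -> R) (hxi : is_lgl_nodes xi) :
  (exists! M : 'M[R]_(N.+1 * m + N.+1 * m), is_system_matrix xi A a b c d M) /\
  (forall M : 'M[R]_(N.+1 * m + N.+1 * m), is_system_matrix xi A a b c d M ->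
     forall z : R[i], eigenvalue (map_mx (real_complex R) M) z ->
       complex.Re z <= 0).
Proof.
have hac : a < c by exact: lt_trans hbc.
have hbd : b < d by exact: lt_trans hcd.
split; first exact: overset_system_matrix.
move=> M MP z /eigenvalue_real_parts[x1 [x2 [x_neq0 Mx1 Mx2]]].
rewrite leNgt; apply/negP => Rez_gt0; apply: x_neq0.
have [Q [l [unitQ defA defB]]] := absmx_diagonalization hA.
have stU k1 k2 : state_U (k1 *: x1 + k2 *: x2) =
    k1 *: state_U x1 + k2 *: state_U x2.
  by rewrite /state_U !(linearD, linearZ).
have stV k1 k2 : state_V (k1 *: x1 + k2 *: x2) =
    k1 *: state_V x1 + k2 *: state_V x2.
  by rewrite /state_V !(linearD, linearZ).
have eqs1 : overset_dgsem xi A a b c d (state_U x1) (state_V x1)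
    (complex.Re z *: state_U x1 - complex.Im z *: state_U x2)
    (complex.Re z *: state_V x1 - complex.Im z *: state_V x2).
  by apply/MP; rewrite -!scaleNr -stU -stV !state_vecK Mx1 scaleNr.
have eqs2 : overset_dgsem xi A a b c d (state_U x2) (state_V x2)
    (complex.Im z *: state_U x1 + complex.Re z *: state_U x2)
    (complex.Im z *: state_V x1 + complex.Re z *: state_V x2).
  by apply/MP; rewrite -stU -stV !state_vecK Mx2.
(* The rows of Q^-1 are left eigenvectors, and the same rows serve A and |A|. *)
have rowQ (B : 'M[R]_m) (k : 'rV[R]_m) i : B = Q *m diag_mx k *m invmx Q ->
    row i (invmx Q) *m B = k 0 i *: row i (invmx Q).
  move=> ->; rewrite !mulmxA -row_mul mulVmx // -row_mul mul1mx.
  by rewrite -row_mul mul_diag_mx; apply/rowP => j; rewrite !mxE.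
have mode i : [/\ row i (invmx Q) *m state_U x1 = 0, row i (invmx Q) *m state_V x1 = 0,
    row i (invmx Q) *m state_U x2 = 0 & row i (invmx Q) *m state_V x2 = 0].
  have absQ : row i (invmx Q) *m absmx A = `|l 0 i| *: row i (invmx Q).
    by rewrite (rowQ _ _ i defB) mxE.
  exact: (overset_growing_mode_eq0 hN hxi hac hbd (rowQ _ _ i defA) absQ
    Rez_gt0 eqs1 eqs2).
(* These rows form an invertible matrix, so a grid function without modal components is zero. *)
have eq0 (W : 'M[R]_(m, N.+1)) : (forall i, row i (invmx Q) *m W = 0) -> W = 0.
  move=> W0; rewrite -[W](mulKVmx unitQ).
  suff -> : invmx Q *m W = 0 by rewrite mulmx0.
  by apply/row_matrixP => i; rewrite row_mul W0 row0.
have state0 x : state_U x = 0 -> state_V x = 0 -> x = 0.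
  move=> U0 V0; rewrite -(state_vecK x) U0 V0 /state_vec !trmx0 !linear0.
  by rewrite col_mx0.
by split; apply: state0; apply: eq0 => i; have [] := mode i.
Qed.
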